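(* Let $i:A\hookrightarrow X$ be a cofibration, where $A$ is a compact topological space, and let $M$ be a manifold. Then the restriction map $i^*:C(X,M)\to C(A,M)$, $f\mapsto f\circ i$, is a locally trivial fiber bundle on any connected component of $C(A,M)$.
   Context: $M$ is a finite-dimensional smooth manifold without boundary. $C(X,M)$ and $C(A,M)$ are spaces of continuous maps with the compact-open topology. A cofibration is a map with the homotopy extension property with respect to all topological spaces. ''Locally trivial fiber bundle on any connected component'' means: for each connected component $Z$ of $C(A,M)$, the restriction $(i^* )^{-1}(Z)\to Z$ is a locally trivial fiber bundle (fibers may be empty, and may differ between components). *)

(* Defs.v *)
From HB Require Import structures.
From mathcomp Require Import all_boot all_order all_algebra.
From mathcomp Require Import all_classical all_reals all_analysis.

Set Implicit Arguments.
Unset Strict Implicit.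
Unset Printing Implicit Defensive.

Import Order.TTheory GRing.Theory Num.Theory.
Import numFieldNormedType.Exports.

Local Open Scope classical_set_scope.
Local Open Scope ring_scope.

(* [:: j1; ...; jk] is sent to the k-th order partial derivative
   d_j1 (... (d_jk f)). *)
Definition partials (R : realType) (m n : nat) (s : seq 'I_m)
    (f : 'rV[R]_m -> 'rV[R]_n) : 'rV[R]_m -> 'rV[R]_n :=
  foldr (fun j g x => 'D_(delta_mx 0 j) g x) f s.

(* C^oo on U.  Meant for open U: the values of f outside U are then
   irrelevant. *)
Definition smooth_on (R : realType) (m n : nat) (U : set 'rV[R]_m)
    (f : 'rV[R]_m -> 'rV[R]_n) : Prop :=
  forall (s : seq 'I_m) (x : 'rV[R]_m), U x ->
    {for x, continuous (partials s f)} /\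
    forall j : 'I_m, derivable (partials s f) x (delta_mx 0 j).

(* Both maps of a chart are total functions; only their restrictions to
   [chart_dom] and [chart_cod] matter. *)
Record chart (R : realType) (n : nat) (M : topologicalType) := Chart {
  chart_dom : set M;
  chart_cod : set 'rV[R]_n;
  chart_map : M -> 'rV[R]_n;
  chart_inv : 'rV[R]_n -> M;
  chart_dom_open : open chart_dom;
  chart_cod_open : open chart_cod;
  chart_map_fun : set_fun chart_dom chart_cod chart_map;
  chart_inv_fun : set_fun chart_cod chart_dom chart_inv;
  chart_mapK : {in chart_dom, cancel chart_map chart_inv};
  chart_invK : {in chart_cod, cancel chart_inv chart_map};
  chart_map_continuous : {within chart_dom, continuous chart_map};
  chart_inv_continuous : {within chart_cod, continuous chart_inv}
}.

(* The atlas need not be maximal. *)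
Record smoothManifold (R : realType) (n : nat) := SmoothManifold {
  manifold_carrier :> topologicalType;
  manifold_hausdorff : hausdorff_space manifold_carrier;
  manifold_second_countable : @second_countable manifold_carrier;
  atlas : set (chart R n manifold_carrier);
  atlas_cover : \bigcup_(c in atlas) chart_dom c = setT;
  atlas_smooth : forall c d, atlas c -> atlas d ->
    smooth_on (chart_cod c `&` chart_inv c @^-1` chart_dom d)
      (chart_map d \o chart_inv c)
}.

Definition unit_interval (R : realType) : set R := `[0, 1].
Arguments unit_interval : clear implicits.

Fact mem_interval0 (R : realType) : (0 : R) \in unit_interval R.
Proof. by rewrite inE /unit_interval /= in_itv /= lexx ler01. Qed.

Definition interval0 (R : realType) : unit_interval R :=
  exist _ 0 (mem_interval0 R).

(* C(X, Y) with the compact-open topology. *)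
Definition cmap (X Y : topologicalType) : topologicalType :=
  initial_topology
    (fun f : continuousType X Y => (f : X -> Y) : {compact-open, X -> Y}).

Definition precomp (A X Y : topologicalType) (i : continuousType A X)
    (f : cmap X Y) : cmap A Y :=
  ((f : continuousType X Y) \o i : continuousType A Y).

Definition cofibration (R : realType) (A X : topologicalType)
    (i : continuousType A X) : Prop :=
  forall (Y : topologicalType) (f : X -> Y) (H : A * unit_interval R -> Y),
    continuous f -> continuous H ->
    (forall a, H (a, interval0 R) = f (i a)) ->
    exists G : X * unit_interval R -> Y,
      [/\ continuous G,
          forall x, G (x, interval0 R) = f x &
          forall a t, G (i a, t) = H (a, t)].

Definition locally_trivial_bundle (E B : topologicalType) (p : E -> B) : Prop :=
  continuous p /\
  exists F : topologicalType, forall b : B, exists2 U : set B, open_nbhs b U &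
    exists (phi : p @^-1` U -> U * F) (psi : U * F -> p @^-1` U),
      [/\ continuous phi, continuous psi, cancel phi psi, cancel psi phi &
          forall e, \val (phi e).1 = p (\val e)].

Definition restrict_over (E B : Type) (p : E -> B) (Z : set B)
    (e : p @^-1` Z) : Z :=
  exist _ (p (\val e)) (mem_set (set_mem (valP e))).
Arguments restrict_over [E B] p Z e.

(* Main.v *)
Require Import Defs.
From HB Require Import structures.
From mathcomp Require Import all_boot all_order all_algebra.
From mathcomp Require Import all_classical all_reals all_analysis.
From mathcomp Require Import ring lra.

Set Implicit Arguments.
Unset Strict Implicit.
Unset Printing Implicit Defensive.

Import Order.TTheory GRing.Theory Num.Theory.
Import numFieldNormedType.Exports.

Local Open Scope classical_set_scope.
Local Open Scope ring_scope.

(** Why restriction along [i] is locally trivial.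

    Fix [b : A -> M].  A map [c : A -> M] close to [b] can be reached from [b]
    by moving the points [b a] along homeomorphisms of [M] that depend
    continuously on [c] and [a].  If such homeomorphisms are spread out over
    [X], i.e. if for [c] near [b] there are homeomorphisms [psi c x] of [M],
    jointly continuous in [c], [x] and the point, with [psi c (i a) (b a) = c a],
    then [f |-> (x |-> psi c x (f x))] is a homeomorphism from the fibre of
    restriction over [b] onto the fibre over [c], and it varies continuously
    with [c].  This is a trivialization near [b].

    The homeomorphisms come from two ingredients.

    - On the manifold side, a coordinate ball is homeomorphic to a vector space
      [E], and a translation of [E], read in the ball, extends by the identity
      to the whole of [M].  The explicit formula [ball_translation] makes this
      an operation [push : E -> M -> M] that is continuous on the product and
      satisfies [push (- v) (push v p) = p] (record [pushing], lemma
      [chart_pushing]).  Translating by the difference of the coordinates of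
      [q] and [p] sends [p] to [q].

    - On the side of [X], the homotopy extension property applied to the open
      cone on [A] (the half-open cylinder with its bottom crushed to a point,
      where a neighbourhood of the apex contains a uniform slice) gives a map
      from [X] to this cone that sends [i a] to the point [a] at height 1
      (lemma [cofibration_collar]).  A displacement defined on [A] is spread
      out over [X] by scaling it with the height, so that it vanishes at the
      apex; compactness of [A] gives continuity there.

    One chart moves only the points [b a] that lie in it.  The displacement is
    therefore cut off by a bump function, which is done for finitely many
    charts in succession: each step brings the points [b a] where its bump
    function is 1 to their target [c a], and leaves in place those that have
    already arrived (lemma [motion_to_push]).  Compactness of [A] makes
    finitely many steps suffice ([motion_to_all]).

    Local transport between fibres makes the set of maps whose fibre is
    equivalent to a given one open, so all the fibres over a connected set are
    homeomorphic, and a single fibre serves for the whole component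
    ([transportable_locally_trivial]). *)

(** * Continuity at a point *)

Section ContinuityAt.
Context (X Y Z W : topologicalType) (x : X).

Lemma continuous_at_pair (f : X -> Y) (g : X -> Z) :
  {for x, continuous f} -> {for x, continuous g} ->
  {for x, continuous (fun t => (f t, g t))}.
Proof. by move=> cf cg; exact: cvg_pair cf cg. Qed.

Lemma continuous_at_comp2 (h : Y -> Z -> W) (f : X -> Y) (g : X -> Z) :
  {for x, continuous f} -> {for x, continuous g} ->
  {for (f x, g x), continuous (fun z : Y * Z => h z.1 z.2)} ->
  {for x, continuous (fun t => h (f t) (g t))}.
Proof.
move=> cf cg; exact: (@continuous_comp _ _ _ (fun t => (f t, g t))
  (fun z : Y * Z => h z.1 z.2) x (continuous_at_pair cf cg)).
Qed.

Lemma continuous_at_near (f g : X -> Y) :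
  {for x, continuous f} -> (\forall t \near x, f t = g t) ->
  {for x, continuous g}.
Proof.
move=> cf fg; have fgx := nbhs_singleton fg.
change (g @ x --> g x); rewrite -fgx.
apply: cvg_trans cf; apply: near_eq_cvg.
by apply: filterS fg => t ->.
Qed.

End ContinuityAt.

(** * Locally trivial bundles from transport between fibres *)

Lemma continuous_set_type (X Y : topologicalType) (A : set Y) (f : X -> A) :
  continuous (fun x => set_val (f x)) -> continuous f.
Proof. exact: (@continuous_comp_initial A X Y set_val). Qed.

(** The two maps are defined and continuous on the whole total space, and only
    their restrictions to the fibres have to be inverse to each other: this
    avoids subspaces when equivalences are composed. *)
Definition fibre_equiv (E B : topologicalType) (p : E -> B) (b c : B) : Prop :=
  exists f g : E -> E,
    [/\ continuous f, continuous g,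
        forall e, p e = b -> p (f e) = c /\ g (f e) = e &
        forall e, p e = c -> p (g e) = b /\ f (g e) = e].

Lemma fibre_equiv_refl (E B : topologicalType) (p : E -> B) b :
  fibre_equiv p b b.
Proof. by exists id, id; split => // e; exact: cvg_id. Qed.

Lemma fibre_equiv_sym (E B : topologicalType) (p : E -> B) b c :
  fibre_equiv p b c -> fibre_equiv p c b.
Proof. by move=> [f [g [cf cg fg gf]]]; exists g, f. Qed.

Lemma fibre_equiv_trans (E B : topologicalType) (p : E -> B) c b d :
  fibre_equiv p b c -> fibre_equiv p c d -> fibre_equiv p b d.
Proof.
move=> [f [g [cf cg fg gf]]] [f' [g' [cf' cg' fg' gf']]].
exists (f' \o f), (g \o g'); split => [e|e|e pe|e pe] /=.
- by apply: continuous_comp; [exact: cf|exact: cf'].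
- by apply: continuous_comp; [exact: cg'|exact: cg].
- have [pf gfe] := fg _ pe; have [-> g'f'] := fg' _ pf.
  by rewrite g'f'.
- have [pg' f'g'] := gf' _ pe; have [-> fg1] := gf _ pg'.
  by rewrite fg1.
Qed.

(** [F c] and [G c] are mutually inverse self-homeomorphisms of the total space
    that match the fibre over [b] with the fibre over [c]; nothing is said of
    the other fibres. *)
Definition local_transport (E B : topologicalType) (p : E -> B) (b : B)
    (U : set B) (F G : B -> E -> E) : Prop :=
  forall c e, U c ->
    [/\ {for (c, e), continuous (fun z : B * E => F z.1 z.2)},
        {for (c, e), continuous (fun z : B * E => G z.1 z.2)},
        G c (F c e) = e, F c (G c e) = e &
        (p e = b -> p (F c e) = c) /\ (p e = c -> p (G c e) = b)].

Definition transportable (E B : topologicalType) (p : E -> B) : Prop :=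
  forall b, exists2 U, open_nbhs b U & exists F G, local_transport p b U F G.

Lemma local_transport_fibre_equiv (E B : topologicalType) (p : E -> B)
    b U F G c :
  local_transport p b U F G -> U c -> fibre_equiv p b c.
Proof.
move=> FG Uc; exists (F c), (G c); split => [e|e|e pe|e pe].
- have [cF _ _ _ _] := FG c e Uc.
  apply: (@continuous_comp _ _ _ (pair c) (fun z : B * E => F z.1 z.2)) => //.
  by apply: cvg_pair; [exact: cvg_cst|exact: cvg_id].
- have [_ cG _ _ _] := FG c e Uc.
  apply: (@continuous_comp _ _ _ (pair c) (fun z : B * E => G z.1 z.2)) => //.
  by apply: cvg_pair; [exact: cvg_cst|exact: cvg_id].
- by have [_ _ GF _ [pF _]] := FG c e Uc; split => //; exact: pF.
- by have [_ _ _ FGe [_ pG]] := FG c e Uc; split => //; exact: pG.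
Qed.

(** The equivalence classes of base points are open because of local transport,
    hence also closed, each being the complement of the union of the others. *)
Lemma connected_fibre_equiv (E B : topologicalType) (p : E -> B)
    (Z : set B) b c :
  transportable p -> connected Z -> Z b -> Z c -> fibre_equiv p b c.
Proof.
move=> tp cZ Zb Zc.
have openE d : open [set x | fibre_equiv p d x].
  rewrite openE => x /= dx; have [U Ux [F [G FG]]] := tp x.
  apply: filterS (open_nbhs_nbhs Ux) => y Uy /=.
  exact: fibre_equiv_trans dx (local_transport_fibre_equiv FG Uy).
suff H : Z `&` [set x | fibre_equiv p b x] = Z.
  by move: Zc; rewrite -{1}H => -[].
apply: cZ.
- by exists b; split => //; exact: fibre_equiv_refl.
- by exists [set x | fibre_equiv p b x].
- exists [set x | fibre_equiv p b x] => //.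
  rewrite (_ : [set x | _] = ~` \bigcup_(d in ~` [set x | fibre_equiv p b x])
    [set x | fibre_equiv p d x]).
    by apply: open_closedC; apply: bigcup_open.
  apply/seteqP; split => x /=.
    move=> bx [d /= nbd dx]; apply: nbd; apply: fibre_equiv_trans bx _.
    exact: fibre_equiv_sym.
  move=> nx; apply: contrapT => nbx; apply: nx; exists x => //.
  exact: fibre_equiv_refl.
Qed.

(** Over [U] the trivialization transports a point back to the fibre over [b]
    and then into the model fibre, the one over a chosen point [g] of [Z]. *)
Lemma transportable_locally_trivial (E B : topologicalType) (p : E -> B)
    (Z : set B) :
  continuous p -> transportable p -> connected Z ->
  locally_trivial_bundle (restrict_over p Z).
Proof.
move=> cp tp cZ; split.
  apply: continuous_set_type => e.
  apply: (@continuous_comp _ _ _ set_val p); last exact: cp.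
  exact: initial_continuous.
have [[g Zg]|Z0] := pselect (exists g, Z g); last first.
  by exists E => -[b Zb]; case: Z0; exists b; exact: set_mem.
exists (p @^-1` [set g]) => -[b Zb'].
have Zb := set_mem Zb'.
have [U [oU Ub] [F [G FG]]] := tp b.
have [f [h [cf ch fh hf]]] := connected_fibre_equiv tp cZ Zg Zb.
exists (set_val @^-1` U).
  by split => //; exists U.
pose S : set Z := set_val @^-1` U.
pose P := restrict_over p Z @^-1` S.
have hG (e : P) : (p @^-1` [set g])
    (h (G (p (set_val (set_val e))) (set_val (set_val e)))).
  have Ue : U (p (set_val (set_val e))) := set_valP e.
  have [_ _ _ _ [_ pG]] := FG _ (set_val (set_val e)) Ue.
  by have [? _] := hf _ (pG erefl).
pose Ff (z : S * (p @^-1` [set g])) :=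
  F (set_val (set_val z.1)) (f (set_val z.2)).
have pFf z : p (Ff z) = set_val (set_val z.1).
  have Uz : U (set_val (set_val z.1)) := set_valP z.1.
  have [_ _ _ _ [pF _]] := FG _ (f (set_val z.2)) Uz.
  by apply: pF; have [] := fh (set_val z.2) (set_valP z.2).
have ZFf z : Z (p (Ff z)) by rewrite pFf; exact: set_valP.
have SFf z : P (SigSub (mem_set (ZFf z))).
  by change (U (p (Ff z))); rewrite pFf; exact: (set_valP z.1).
have SP (e : P) : S (restrict_over p Z (set_val e)) := set_valP e.
have cval2 : continuous (fun e : P => set_val (set_val e)).
  move=> e; apply: (@continuous_comp _ _ _ set_val set_val);
    exact: initial_continuous.
have cpval : continuous (fun e : P => p (set_val (set_val e))).
  move=> e; apply: (@continuous_comp _ _ _ (fun e : P =>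
    set_val (set_val e)) p); [exact: cval2|exact: cp].
exists (fun e => ((SigSub (mem_set (SP e)) : S),
                  (SigSub (mem_set (hG e)) : p @^-1` [set g]))).
exists (fun z => (SigSub (mem_set (SFf z)) : P)).
have c1 : continuous (fun e : P => SigSub (mem_set (SP e)) : S).
  apply: continuous_set_type; apply: continuous_set_type.
  exact: cpval.
have c2 : continuous (fun e : P => SigSub (mem_set (hG e)) : p @^-1` [set g]).
  apply: continuous_set_type => e.
  have [_ cG _ _ _] := FG _ (set_val (set_val e)) (set_valP e).
  apply: (@continuous_comp _ _ _ (fun e : P =>
    G (p (set_val (set_val e))) (set_val (set_val e))) h); last exact: ch.
  apply: (@continuous_comp _ _ _
    (fun e : P => (p (set_val (set_val e)), set_val (set_val e)))
    (fun z : B * E => G z.1 z.2)); last exact: cG.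
  exact: cvg_pair (cpval e) (cval2 e).
have cz1 : continuous (fun z : S * (p @^-1` [set g]) => set_val (set_val z.1)).
  move=> z; apply: (@continuous_comp _ _ _
    (fun z : S * _ => set_val z.1) set_val); last exact: initial_continuous.
  apply: (@continuous_comp _ _ _ fst set_val); last exact: initial_continuous.
  exact: cvg_fst.
have cz2 : continuous (fun z : S * (p @^-1` [set g]) => f (set_val z.2)).
  move=> z; apply: (@continuous_comp _ _ _
    (fun z : _ * (p @^-1` [set g]) => set_val z.2) f); last exact: cf.
  apply: (@continuous_comp _ _ _ snd set_val); last exact: initial_continuous.
  exact: cvg_snd.
split.
- by move=> e; exact: cvg_pair (c1 e) (c2 e).
- apply: continuous_set_type; apply: continuous_set_type => z.
  have [cF _ _ _ _] := FG _ (f (set_val z.2)) (set_valP z.1).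
  apply: (@continuous_comp _ _ _
    (fun z : S * (p @^-1` [set g]) =>
      (set_val (set_val z.1), f (set_val z.2)))
    (fun z : B * E => F z.1 z.2)); last exact: cF.
  exact: cvg_pair (cz1 z) (cz2 z).
- move=> e; apply/val_inj/val_inj => /=; rewrite /Ff /=.
  have [_ _ _ FGe [_ pG]] := FG _ (set_val (set_val e)) (set_valP e).
  by have [_ ->] := hf _ (pG erefl); exact: FGe.
- move=> [z1 z2]; congr pair; [apply/val_inj/val_inj|apply/val_inj].
    exact: pFf.
  have [_ _ GF _ _] := FG _ (f (set_val z2)) (set_valP z1).
  rewrite /= pFf /Ff GF.
  by have [_ ->] := fh (set_val z2) (set_valP z2).
- by move=> e.
Qed.

(** * The open cone and the collar of a cofibration *)

(** [None] is the apex and [Some (a, t)] the point of the ray through [a] at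
    height [t].  Heights range over all of [R]: only those near the interval
    from 0 to 1 occur, and the apex is not identified with the points of
    height 0. *)
Definition open_cone (A : Type) (R : realType) : Type := option (A * R).

Section OpenCone.
Context (R : realType) (A : topologicalType).

(** A neighbourhood of the apex has to contain a slice that is uniform in [a]: a
    point near the apex is thus a point of small height, whichever ray it is
    on.  Compared with a quotient topology there are fewer open sets, and it is
    easier for a map into the cone to be continuous. *)
Definition cone_open : set_system (open_cone A R) :=
  [set O | open (Some @^-1` O : set (A * R)) /\
    (O None -> exists2 e : R, 0 < e & forall p, `|p.2| < e -> O (Some p))].

Let cone_openT : cone_open setT.
Proof. by split; [exact: openT|exists 1]. Qed.

Let cone_openI : setI_closed cone_open.
Proof.
move=> O P [oO O0] [oP P0]; split; first exact: openI.
move=> [/O0[e e0 He] /P0[d d0 Hd]]; exists (Num.min e d).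
  by rewrite lt_min e0.
by move=> p; rewrite lt_min => /andP[? ?]; split; [exact: He|exact: Hd].
Qed.

Let cone_open_bigU (I : Type) (f : I -> set (open_cone A R)) :
  (forall i, cone_open (f i)) -> cone_open (\bigcup_i f i).
Proof.
move=> fo; split.
  by rewrite preimage_bigcup; apply: bigcup_open => i _; case: (fo i).
move=> [i _ fi]; have [_ /(_ fi)[e e0 He]] := fo i.
by exists e => // p pe; exists i => //; exact: He.
Qed.

HB.instance Definition _ := Choice.copy (open_cone A R) (option (A * R)%type).
HB.instance Definition _ := isOpenTopological.Build (open_cone A R)
  cone_openT cone_openI cone_open_bigU.

Lemma cone_openP (O : set (open_cone A R)) : open O = cone_open O.
Proof. by []. Qed.

Lemma nbhs_cone_Some (p : A * R) (W : set (A * R)) :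
  nbhs p W -> nbhs (Some p : open_cone A R) (Some @` W).
Proof.
rewrite nbhsE => -[V [oV Vp] VW].
apply: (filterS (P := Some @` V)); first exact: image_subset.
apply: open_nbhs_nbhs; split; last by exists p.
rewrite cone_openP; split; last by case.
rewrite (_ : _ @^-1` _ = V) //; apply/seteqP.
by split=> [x [y Vy [<-]]|x Vx] //=; exists x.
Qed.

Lemma nbhs_cone_None (e : R) : 0 < e ->
  nbhs (None : open_cone A R) [set y | forall p, y = Some p -> `|p.2| < e].
Proof.
move=> e0; apply: open_nbhs_nbhs; split; last by [].
rewrite cone_openP; split; last by move=> _; exists e => // p pe _ [<-].
rewrite (_ : _ @^-1` _ = [set p : A * R | `|p.2| < e]); last first.
  by apply/seteqP; split => [p /(_ p erefl)|p pe _ [<-]].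
apply: (@open_comp _ _ (fun p : A * R => `|p.2|) [set x | x < e]).
  move=> p _; apply: (@continuous_comp _ _ _ snd (fun x : R => `|x|)).
    exact: cvg_snd.
  exact: norm_continuous.
exact: open_lt.
Qed.

End OpenCone.

Fact mem_interval1 (R : realType) : (1 : R) \in unit_interval R.
Proof. by rewrite inE /unit_interval /= in_itv /= lexx ler01. Qed.

Definition interval1 (R : realType) : unit_interval R :=
  exist _ 1 (mem_interval1 R).

(** The homotopy [(a, t) |-> Some (a, t)], which starts at the constant map to
    the apex, extends to [X]; its value at time 1 is the collar.  It plays the
    role of the retraction of a neighbourhood of the image of [A], together with
    a function that is 1 on this image and vanishes outside the neighbourhood. *)
Lemma cofibration_collar (R : realType) (A X : topologicalType)
    (i : continuousType A X) :
  cofibration R i -> exists2 k : X -> open_cone A R,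
    continuous k & forall a, k (i a) = Some (a, 1).
Proof.
move=> cof.
pose H (z : A * unit_interval R) : open_cone A R :=
  if set_val z.2 == 0 then None else Some (z.1, set_val z.2).
have cH : continuous H.
  have cval : continuous (fun t : A * unit_interval R => set_val t.2).
    move=> t; apply: (@continuous_comp _ _ _ (@snd A _) set_val);
      [exact: cvg_snd|exact: initial_continuous].
  pose j (z : A * unit_interval R) : A * R := (z.1, set_val z.2).
  have cj : continuous j.
    move=> z; apply: continuous_at_pair; first exact: cvg_fst.
    exact: cval.
  apply/continuousP => O; rewrite cone_openP => -[oO ONone].
  rewrite openE => z; rewrite /H /=; case: eqP => [z0 ON|z0 Oz].
    have [e e0 He] := ONone ON.
    have : nbhs z [set t : A * unit_interval R | `|set_val t.2| < e].
      have cn : continuous (fun t : A * unit_interval R => `|set_val t.2|).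
        move=> t.
        apply: (@continuous_comp _ _ _ _ (fun x : R => `|x|)) (cval t) _.
        exact: norm_continuous.
      apply: (cn z [set x | x < e]); apply: open_nbhs_nbhs.
      split; first exact: open_lt.
      by rewrite /= z0 normr0.
    apply: filterS => t /= te; rewrite /H; case: ifP => // _.
    exact: He.
  apply: (cj z [set p : A * R | O (if p.2 == 0 then None else Some p)]).
  apply: (filterS (P := Some @^-1` O `&` [set p | p.2 != 0])).
    by move=> p [Op /negbTE p0] /=; rewrite p0; case: p Op {p0}.
  apply: filterI; first exact: open_nbhs_nbhs.
  have c2 : {for j z, continuous (@snd A R)} by exact: cvg_snd.
  apply: (c2 [set t | t != 0]); apply: open_nbhs_nbhs; split; last exact/eqP.
  exact: open_neq.
have [//|//||G [cG _ HG]] := cof (open_cone A R) (fun=> None) H.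
- by move=> x; exact: cvg_cst.
- by move=> a; rewrite /H eqxx.
exists (fun x => G (x, interval1 R)).
  move=> x; apply: (@continuous_comp _ _ _ (fun x => (x, interval1 R)) G);
    last exact: cG.
  by apply: continuous_at_pair; [exact: cvg_id|exact: cvg_cst].
by move=> a; rewrite HG /H /= oner_eq0.
Qed.
(** * Translations of the unit ball *)

(** The map [ball_unfold : y |-> y / (1 - |y|)] is a homeomorphism from the open
    unit ball onto the vector space, with inverse [w |-> w / (1 + |w|)].
    [ball_translation v] is the translation by [v] seen through it.  For
    [d = 1 - |y|], clearing denominators in [w = y / d + v] gives
    [(y + d v) / (d + |y + d v|)].  When [d] is replaced by its positive part
    and the other denominator is written [1 + |y + d v| - |y|], the formula
    makes sense everywhere and is the identity outside the ball, so that its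
    continuity does not require any gluing. *)
Section BallTranslation.
Context (R : realType) (E : normedModType R).
Implicit Types (v y p q : E).

Definition ball_shift v y : E := y + Num.max 0 (1 - `|y|) *: v.

Definition ball_translation v y : E :=
  (1 + `|ball_shift v y| - `|y|)^-1 *: ball_shift v y.

Definition ball_unfold y : E := (1 - `|y|)^-1 *: y.

Lemma ball_translation_denom_gt0 v y : 0 < 1 + `|ball_shift v y| - `|y|.
Proof.
have [y1|y1] := leP 1 `|y|.
  rewrite /ball_shift max_l ?subr_le0// scale0r addr0; lra.
by rewrite addrAC ltr_pwDl// subr_gt0.
Qed.

Lemma ball_translation_out v y : 1 <= `|y| -> ball_translation v y = y.
Proof.
move=> y1; rewrite /ball_translation /ball_shift max_l ?subr_le0//.
by rewrite scale0r addr0 addrK invr1 scale1r.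
Qed.

Lemma ball_translation0 y : ball_translation 0 y = y.
Proof.
by rewrite /ball_translation /ball_shift scaler0 addr0 addrK invr1 scale1r.
Qed.

Lemma ball_translation_in v y : `|y| < 1 -> `|ball_translation v y| < 1.
Proof.
move=> y1; rewrite /ball_translation.
have D0 := ball_translation_denom_gt0 v y.
rewrite normrZ gtr0_norm ?invr_gt0// mulrC ltr_pdivrMr// mul1r; lra.
Qed.

Lemma ball_translationN v y : ball_translation (- v) (ball_translation v y) = y.
Proof.
have [y1|y1] := leP 1 `|y|; first by rewrite !ball_translation_out.
have z1 := ball_translation_in v y1.
have D0 := ball_translation_denom_gt0 v y.
set z := ball_translation v y in z1 *.
set D := 1 + `|ball_shift v y| - `|y| in D0.
have sE : ball_shift v y = y + (1 - `|y|) *: v.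
  by rewrite /ball_shift max_r// subr_ge0 ltW.
have zE : z = D^-1 *: y + (D^-1 * (1 - `|y|)) *: v.
  by rewrite /z /ball_translation -/D sE scalerDr scalerA.
(* with d = 1 - |y|, the point z is at distance d / D from the sphere *)
have nz : 1 - `|z| = D^-1 * (1 - `|y|).
  rewrite /z /ball_translation -/D normrZ gtr0_norm ?invr_gt0//.
  apply: (@mulfI _ D); first by rewrite gt_eqF.
  rewrite mulrBr !mulrA mulfV ?gt_eqF// !mul1r mulr1 /D; lra.
have szE : ball_shift (- v) z = D^-1 *: y.
  rewrite /ball_shift max_r ?subr_ge0 1?ltW// nz zE scalerN addrK//.
rewrite /ball_translation szE normrZ gtr0_norm ?invr_gt0//.
(* the denominators of the two translations are inverse to each other *)
have -> : 1 + D^-1 * `|y| - `|z| = D^-1 by rewrite addrAC nz; ring.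
by rewrite invrK scalerA mulfV ?scale1r// gt_eqF.
Qed.

Lemma ball_translation_unfold p q : `|p| < 1 -> `|q| < 1 ->
  ball_translation (ball_unfold q - ball_unfold p) p = q.
Proof.
move=> p1 q1.
have p0 : 0 < 1 - `|p| by rewrite subr_gt0.
have q0 : 0 < 1 - `|q| by rewrite subr_gt0.
have sE : ball_shift (ball_unfold q - ball_unfold p) p =
    ((1 - `|p|) / (1 - `|q|)) *: q.
  rewrite /ball_shift max_r ?ltW// scalerBr !scalerA mulfV ?gt_eqF// scale1r.
  by rewrite addrC subrK.
rewrite /ball_translation sE normrZ gtr0_norm ?divr_gt0// scalerA.
rewrite (_ : _ * _ = 1) ?scale1r//.
set a := `|p| in p0 *; set b := `|q| in q0 *.
have -> : 1 + (1 - a) / (1 - b) * b - a = (1 - a) / (1 - b).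
  by field; lra.
by rewrite mulVf// gt_eqF// divr_gt0.
Qed.

Lemma continuous_ball_translation :
  continuous (fun z : E * E => ball_translation z.1 z.2).
Proof.
have cs : continuous (fun z : E * E => ball_shift z.1 z.2).
  move=> z; apply: cvgD; first exact: cvg_snd.
  apply: cvgZ; last exact: cvg_fst.
  apply: (@continuous_at_comp2 _ _ _ _ z (fun a b : R => Num.max a b)
    (fun=> 0) (fun z : E * E => 1 - `|z.2|)).
  - exact: cvg_cst.
  - apply: cvgB; first exact: cvg_cst.
    by apply: cvg_norm; exact: cvg_snd.
  - exact: max_continuous.
move=> z; apply: cvgZ; last exact: cs.
apply: cvgV; first by rewrite gt_eqF// ball_translation_denom_gt0.
apply: cvgB; last by apply: cvg_norm; exact: cvg_snd.
by apply: cvgD; [exact: cvg_cst|apply: cvg_norm; exact: cs].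
Qed.

Lemma continuous_ball_unfold y : `|y| < 1 -> {for y, continuous ball_unfold}.
Proof.
move=> y1; apply: cvgZ; last exact: cvg_id.
apply: cvgV; first by rewrite gt_eqF// subr_gt0.
by apply: cvgB; [exact: cvg_cst|exact: cvg_norm].
Qed.

End BallTranslation.

(** * Pushing points inside a chart *)

(** [push v] is to be thought of as the translation by [v] in the coordinate
    [push_coord] of the patch [push_dom], extended to [M] by the identity.  The
    bump function lives on the smaller closed set [push_core]: [push_coord] is
    uncontrolled when its argument approaches the boundary of the patch, and
    displacements are multiplied by the bump function to avoid this. *)
Record pushing (R : realType) (E : normedModType R) (M : topologicalType) :=
  Pushing {
    push_dom : set M;
    push_core : set M;
    push_coord : M -> E;
    push_bump : M -> R;
    push : E -> M -> M;
    push_dom_open : open push_dom;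
    push_core_closed : closed push_core;
    push_core_dom : push_core `<=` push_dom;
    push_bump0 : forall p, ~ push_core p -> push_bump p = 0;
    push_coord_continuous :
      forall p, push_dom p -> {for p, continuous push_coord};
    push_bump_continuous :
      forall p, push_dom p -> {for p, continuous push_bump};
    push_continuous : continuous (fun z : E * M => push z.1 z.2);
    push0 : forall p, push 0 p = p;
    pushN : forall v p, push (- v) (push v p) = p;
    pushE : forall p q, push_dom p -> push_dom q ->
      push (push_coord q - push_coord p) p = q
  }.

(** The chart is rescaled so that the ball of radius [r] around [p0] becomes the
    unit ball; [f] is the rescaled coordinate. *)
Section ChartBall.
Context (R : realType) (n : nat) (M : topologicalType) (c : chart R n M).
Context (p0 : M) (r : R).
Hypothesis hM : hausdorff_space M.
Hypothesis r0 : 0 < r.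
Let z0 := chart_map c p0.
Hypothesis ball_cod : forall w, `|w - z0| <= r -> chart_cod c w.

Local Notation dom := (chart_dom c).
Local Notation cod := (chart_cod c).

Let unit_coord (w : 'rV[R]_n) : 'rV[R]_n := r^-1 *: (w - z0).
Let of_unit_coord (u : 'rV[R]_n) : 'rV[R]_n := z0 + r *: u.
Let f (p : M) := unit_coord (chart_map c p).

Let unit_coordK w : of_unit_coord (unit_coord w) = w.
Proof.
rewrite /of_unit_coord /unit_coord scalerA mulfV ?gt_eqF// scale1r.
by rewrite addrC subrK.
Qed.

Let of_unit_coordK u : unit_coord (of_unit_coord u) = u.
Proof.
rewrite /of_unit_coord /unit_coord addrAC subrr add0r.
by rewrite scalerA mulVf ?gt_eqF// scale1r.
Qed.

Let cod_of_unit u : `|u| <= 1 -> cod (of_unit_coord u).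
Proof.
move=> u1; apply: ball_cod.
by rewrite /of_unit_coord addrAC subrr add0r normrZ gtr0_norm// ler_piMr// ltW.
Qed.

Let chart_map_at p : dom p -> {for p, continuous (chart_map c)}.
Proof.
move=> dp; have := @chart_map_continuous _ _ _ c.
rewrite (continuous_open_subspace _ (@chart_dom_open _ _ _ c)); apply.
exact/mem_set.
Qed.

Let chart_inv_at w : cod w -> {for w, continuous (chart_inv c)}.
Proof.
move=> dw; have := @chart_inv_continuous _ _ _ c.
rewrite (continuous_open_subspace _ (@chart_cod_open _ _ _ c)); apply.
exact/mem_set.
Qed.

Let mapK p : dom p -> chart_inv c (chart_map c p) = p.
Proof. by move=> dp; apply: chart_mapK; exact/mem_set. Qed.

Let invK w : cod w -> chart_map c (chart_inv c w) = w.
Proof. by move=> dw; apply: chart_invK; exact/mem_set. Qed.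

Let f_at p : dom p -> {for p, continuous f}.
Proof.
move=> dp; apply: cvgZr; apply: cvgB; last exact: cvg_cst.
exact: chart_map_at.
Qed.

Let of_unit_continuous : continuous of_unit_coord.
Proof.
move=> u; apply: (@cvgD _ _ _ (nbhs u) _ (cst z0) (fun u => r *: u)).
  exact: cvg_cst.
by apply: cvgZr; exact: cvg_id.
Qed.

Definition chart_ball (e : R) : set M := [set p | dom p /\ `|f p| <= e].

Let chart_ballE e : e <= 1 ->
  chart_ball e = (chart_inv c \o of_unit_coord) @` [set u | `|u| <= e].
Proof.
move=> e1; apply/seteqP; split => [p [dp fe]|_ [u /= ue <-]].
  by exists (f p) => //=; rewrite /f unit_coordK mapK.
have cu := cod_of_unit (le_trans ue e1).
split; first exact: (@chart_inv_fun _ _ _ c _ cu).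
by rewrite /f invK// of_unit_coordK.
Qed.

Lemma chart_ball_compact e : e <= 1 -> compact (chart_ball e).
Proof.
move=> e1; rewrite chart_ballE//; apply: continuous_compact.
  apply: continuous_in_subspaceT => u /set_mem /= ue.
  apply: continuous_comp; first exact: of_unit_continuous.
  exact: chart_inv_at (cod_of_unit (le_trans ue e1)).
apply: bounded_closed_compact.
  exists e; split; first exact: num_real.
  by move=> x ex u /= ue; apply: le_trans ue _; exact: ltW.
apply: (@closed_comp _ _ (fun u : 'rV[R]_n => `|u|) [set x | x <= e]).
  by move=> u _; exact: norm_continuous.
exact: closed_le.
Qed.

(** This is where [M] has to be separated: the complement of the ball is open in
    the whole of [M], so that the translations of the ball can be extended by
    the identity. *)
Lemma chart_ball_closed e : e <= 1 -> closed (chart_ball e).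
Proof.
by move=> e1; apply: compact_closed => //; exact: chart_ball_compact.
Qed.

Lemma nbhs_chart_lt p e : dom p -> `|f p| < e ->
  nbhs p [set q | dom q /\ `|f q| < e].
Proof.
move=> dp fe; apply: filterI.
  by apply: open_nbhs_nbhs; split => //; exact: chart_dom_open.
have cn : {for p, continuous (fun q => `|f q|)} by apply: cvg_norm; exact: f_at.
apply: (cn [set x | x < e]); apply: open_nbhs_nbhs; split => //.
Qed.

Lemma nbhs_chart_ball e : 0 < e -> dom p0 -> nbhs p0 (chart_ball e).
Proof.
move=> e0 d0; have f0 : `|f p0| < e.
  by rewrite /f /unit_coord subrr scaler0 normr0.
apply: filterS (nbhs_chart_lt d0 f0).
by move=> q [dq fq]; split => //; exact: ltW fq.
Qed.

Let bump p : R :=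
  if p \in dom then Num.max 0 (Num.min 1 (2 - 3 * `|f p|)) else 0.

Let translate (v : 'rV[R]_n) (p : M) : M :=
  if p \in dom then chart_inv c (of_unit_coord (ball_translation v (f p)))
  else p.

Let cod_translation v p : dom p ->
  cod (of_unit_coord (ball_translation v (f p))).
Proof.
move=> dp; have [f1|f1] := leP 1 `|f p|.
  rewrite ball_translation_out// /f unit_coordK.
  exact: (@chart_map_fun _ _ _ c).
by apply: cod_of_unit; apply/ltW; exact: ball_translation_in.
Qed.

Let translate_out v p : dom p -> 1 <= `|f p| -> translate v p = p.
Proof.
move=> dp f1; rewrite /translate mem_set// ball_translation_out//.
by rewrite /f unit_coordK mapK.
Qed.

Let f_translate v p : dom p -> f (translate v p) = ball_translation v (f p).
Proof.
move=> dp; rewrite /translate mem_set// /f invK; last exact: cod_translation.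
by rewrite of_unit_coordK.
Qed.

Let dom_translate v p : dom p -> dom (translate v p).
Proof.
move=> dp; rewrite /translate mem_set//; apply: (@chart_inv_fun _ _ _ c).
exact: cod_translation.
Qed.

(** The formula in coordinates is used on the whole domain of the chart, so
    only the points outside the domain need an argument: near them the
    translation is the identity since the closed ball is closed in [M]. *)
Let translate_continuous :
  continuous (fun z : 'rV[R]_n * M => translate z.1 z.2).
Proof.
move=> [v p]; have [dp|ndp] := pselect (dom p).
  apply: (@continuous_at_near _ _ _ (fun z : 'rV[R]_n * M =>
    chart_inv c (of_unit_coord (ball_translation z.1 (f z.2))))).
    apply: (@continuous_comp _ _ _
      (fun z : 'rV[R]_n * M => of_unit_coord (ball_translation z.1 (f z.2))));
      last exact/chart_inv_at/cod_translation.
    apply: (@continuous_comp _ _ _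
      (fun z : 'rV[R]_n * M => ball_translation z.1 (f z.2)));
      last exact: of_unit_continuous.
    apply: (@continuous_at_comp2 _ _ _ _ _ (@ball_translation _ _) fst
      (f \o snd)); first exact: cvg_fst.
      by apply: (@continuous_comp _ _ _ snd f); [exact: cvg_snd|exact: f_at].
    exact: continuous_ball_translation.
  apply: (filterS (P := snd @^-1` dom)).
    by move=> z dz; rewrite /translate mem_set.
  apply: (@cvg_snd _ _ (nbhs v) (nbhs p)).
  by apply: open_nbhs_nbhs; split => //; exact: chart_dom_open.
apply: (@continuous_at_near _ _ _ snd); first exact: cvg_snd.
apply: (filterS (P := snd @^-1` (~` chart_ball 1))); last first.
  apply: (@cvg_snd _ _ (nbhs v) (nbhs p)).
  apply: open_nbhs_nbhs; split; last by case.
  exact/closed_openC/chart_ball_closed.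
move=> -[u q] /= nq.
have [dq|dq] := pselect (dom q); last by rewrite /translate memNset.
rewrite translate_out// leNgt; apply/negP => fq; apply: nq.
by split => //; exact: ltW.
Qed.

(** The patch is the open unit ball.  The bump function is a clipped affine
    function of the norm, equal to 1 up to radius 1/3 and 0 from radius
    2/3. *)
Lemma chart_pushing : dom p0 -> exists P : pushing ('rV[R]_n) M,
  nbhs p0 [set p | push_bump P p = 1].
Proof.
move=> d0.
pose N := [set p | dom p /\ `|f p| < 1].
have oN : open N by rewrite openE => p [dp fp]; exact: nbhs_chart_lt.
have cS : closed (chart_ball (2 / 3)) by apply: chart_ball_closed; lra.
have SN : chart_ball (2 / 3) `<=` N by move=> p [dp fp]; split => //; lra.
have b0 p : ~ chart_ball (2 / 3) p -> bump p = 0.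
  rewrite /bump; case: ifPn => // /set_mem dp nS.
  rewrite max_l// ge_min; apply/orP; right.
  have : 2 / 3 < `|f p| by rewrite ltNge; apply/negP => fp; apply: nS; split.
  lra.
have cc p : N p -> {for p, continuous (@ball_unfold R _ \o f)}.
  move=> [dp fp]; apply: (@continuous_comp _ _ _ f); first exact: f_at.
  exact: continuous_ball_unfold.
have cb p : N p -> {for p, continuous bump}.
  move=> [dp fp]; apply: (@continuous_at_near _ _ _
      (fun p => Num.max 0 (Num.min 1 (2 - 3 * `|f p|)))).
    apply: (@continuous_max _ _ (fun=> 0)
        (fun p => Num.min 1 (2 - 3 * `|f p|))).
      exact: cvg_cst.
    apply: (@continuous_min _ _ (fun=> 1) (fun p => 2 - 3 * `|f p|)).
      exact: cvg_cst.
    apply: cvgB; first exact: cvg_cst.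
    by apply: cvgM; [exact: cvg_cst|apply: cvg_norm; exact: f_at].
  apply: (filterS (P := dom)); first by move=> q dq; rewrite /bump mem_set.
  by apply: open_nbhs_nbhs; split => //; exact: chart_dom_open.
have t0 p : translate 0 p = p.
  rewrite /translate; case: ifPn => // /set_mem dp.
  by rewrite ball_translation0 /f unit_coordK mapK.
have tN v p : translate (- v) (translate v p) = p.
  have [dp|dp] := pselect (dom p); last by rewrite /translate !memNset.
  rewrite {1}/translate mem_set; last exact: dom_translate.
  by rewrite f_translate// ball_translationN /f unit_coordK mapK.
have tE p q : N p -> N q ->
    translate (ball_unfold (f q) - ball_unfold (f p)) p = q.
  move=> [dp fp] [dq fq]; rewrite /translate mem_set//.
  by rewrite ball_translation_unfold// /f unit_coordK mapK.
exists (Pushing oN cS SN b0 cc cb translate_continuous t0 tN tE) => /=.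
apply: (filterS (P := chart_ball (1 / 3))).
  move=> p [dp fp]; rewrite /= /bump mem_set// min_l; last lra.
  by rewrite max_r.
by apply: nbhs_chart_ball => //; lra.
Qed.

End ChartBall.

Lemma chart_ball_in_cod (R : realType) (n : nat) (M : topologicalType)
    (c : chart R n M) (p : M) : chart_dom c p ->
  exists2 r : R, 0 < r &
    forall w, `|w - chart_map c p| <= r -> chart_cod c w.
Proof.
move=> dp; have : nbhs (chart_map c p) (chart_cod c).
  apply: open_nbhs_nbhs; split; first exact: chart_cod_open.
  exact: (@chart_map_fun _ _ _ c).
move=> /nbhs_ballP[e /= e0 eS]; exists (e / 2); first by rewrite divr_gt0.
move=> w we; apply: eS; rewrite -ball_normE /ball_ /= distrC.
by apply: le_lt_trans we _; rewrite ltr_pdivrMr// ltr_pMr// ltr1n.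
Qed.

Lemma manifold_chart (R : realType) (n : nat) (M : smoothManifold R n) (p : M) :
  exists c : chart R n M, chart_dom c p.
Proof.
have : (\bigcup_(c in @atlas R n M) chart_dom c) p by rewrite atlas_cover.
by move=> [c _ dp]; exists c.
Qed.

Lemma manifold_pushing (R : realType) (n : nat) (M : smoothManifold R n)
    (p : M) :
  exists P : pushing ('rV[R]_n) M, nbhs p [set q | push_bump P q = 1].
Proof.
have [c dp] := manifold_chart p; have [r r0 rS] := chart_ball_in_cod dp.
exact: chart_pushing (@manifold_hausdorff _ _ M) r0 rS dp.
Qed.

Lemma manifold_regular (R : realType) (n : nat) (M : smoothManifold R n) :
  regular_space M.
Proof.
move=> p; have [c dp] := manifold_chart p.
have [r r0 rS] := chart_ball_in_cod dp.
apply: (@compact_regular _ _ (chart_ball c p r 1)).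
- exact: manifold_hausdorff.
- exact: chart_ball_compact.
- exact: nbhs_chart_ball.
Qed.

(** * The compact-open topology *)

Definition cmap_app (X Y : topologicalType) (f : cmap X Y) : X -> Y :=
  (f : continuousType X Y).

Lemma cmap_app_continuous (X Y : topologicalType) (f : cmap X Y) :
  continuous (cmap_app f).
Proof. exact: (@cts_fun _ _ (f : continuousType X Y)). Qed.

Lemma cmap_eqP (X Y : topologicalType) (f g : cmap X Y) :
  cmap_app f =1 cmap_app g -> f = g.
Proof. by move=> fg; apply/continuousEP. Qed.

Lemma nbhs_cmap (X Y : topologicalType) (f : cmap X Y) (K : set X) (O : set Y) :
  compact K -> open O -> (forall x, K x -> O (cmap_app f x)) ->
  nbhs f [set g : cmap X Y | forall x, K x -> O (cmap_app g x)].
Proof.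
move=> cK oO fKO; apply: (@initial_continuous (continuousType X Y)
  {compact-open, X -> Y} (fun g => g : X -> Y) f
  [set g : {compact-open, X -> Y} | forall x, K x -> O (g x)]).
apply: (filterS (P := [set g : {compact-open, X -> Y} | g @` K `<=` O])).
  by move=> g gK x Kx; apply: gK; exists x.
apply: open_nbhs_nbhs; split; first exact: compact_open_open.
by move=> _ [x Kx <-]; exact: fKO.
Qed.

Lemma cvg_cmap (T : Type) (F : set_system T) (X Y : topologicalType)
    (h : T -> cmap X Y) (f : cmap X Y) : Filter F ->
  (forall (K : set X) (O : set Y), compact K -> open O ->
    (forall x, K x -> O (cmap_app f x)) ->
    \forall t \near F, forall x, K x -> O (cmap_app (h t) x)) ->
  h @ F --> f.
Proof.
move=> FF hF U [? /= [[W oW <-] Wf /filterS]]; apply.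
have : ((fun t => cmap_app (h t) : {compact-open, X -> Y}) @ F) -->
    (cmap_app f : {compact-open, X -> Y}).
  apply/compact_open_cvgP => K O cK oO fKO.
  apply: filterS (hF K O cK oO _).
    by move=> t ht _ [x Kx <-]; exact: ht.
  by move=> x Kx; apply: fKO; exists x.
by apply; exact: open_nbhs_nbhs.
Qed.

(** [A] is compact but possibly not separated, hence not locally compact in the
    strong sense.  Regularity of the target replaces this: the preimage of a
    small closed neighbourhood of [f a] is a compact neighbourhood of [a]. *)
Lemma cmap_eval_continuous (A M : topologicalType) :
  compact [set: A] -> regular_space M ->
  continuous (fun z : cmap A M * A => cmap_app z.1 z.2).
Proof.
move=> cA reg [f a] O /= nO.
have [V nV VO] := reg (cmap_app f a) _ (nbhs_interior nO).
exists ([set g : cmap A M | forall x, (cmap_app f @^-1` closure V) x ->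
    interior O (cmap_app g x)], cmap_app f @^-1` V).
  split => /=; last exact: cmap_app_continuous.
  apply: nbhs_cmap.
  - apply: subclosed_compact cA _ => //.
    apply: (@closed_comp _ _ (cmap_app f)); last exact: closed_closure.
    by move=> x _; exact: cmap_app_continuous.
  - exact: open_interior.
  - by move=> x; exact: VO.
move=> [g x] /= [gO Vx]; apply: interior_subset; apply: gO.
exact: subset_closure.
Qed.

(** [X] is arbitrary and [K] is a compact subset of it.  Near [x] in [K] the
    three variables can be controlled separately: the value of [g] at the
    points [y] near [x] is kept in a prescribed open set by a condition on the
    compact set [L], the part of [K] that [f] maps into a small closed
    neighbourhood of [f x]. *)
Lemma cmap_fibrewise_continuous (C X M : topologicalType)
    (psi : C -> X -> M -> M) (phi : C -> cmap X M -> cmap X M) (c : C)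
    (f : cmap X M) : regular_space M ->
  (forall x, {for (c, x, cmap_app f x),
    continuous (fun z : C * X * M => psi z.1.1 z.1.2 z.2)}) ->
  (\forall c' \near c, forall g x,
    cmap_app (phi c' g) x = psi c' x (cmap_app g x)) ->
  {for (c, f), continuous (fun z : C * cmap X M => phi z.1 z.2)}.
Proof.
move=> reg cpsi nphi; apply: cvg_cmap => K O cK oO KO.
have phic := nbhs_singleton nphi.
move/compact_near_coveringP/near_covering_withinP : (cK); apply => x Kx.
have Opsi : nbhs (psi c x (cmap_app f x)) O.
  by apply: open_nbhs_nbhs; split => //; rewrite -phic; exact: KO.
have [[CX Y] /= [[[C1 X1] /= [nC1 nX1] sub1] nY] sub] := cpsi x _ Opsi.
have [V nV VY] := reg (cmap_app f x) _ (nbhs_interior nY).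
pose L := K `&` cmap_app f @^-1` closure V.
pose G := [set g : cmap X M | forall y, L y -> interior Y (cmap_app g y)].
exists (X1 `&` cmap_app f @^-1` V,
  (C1 `&` [set c' | forall g x,
      cmap_app (phi c' g) x = psi c' x (cmap_app g x)]) `*` G).
  split => /=.
    by apply: filterI => //; exact: cmap_app_continuous.
  exists (C1 `&` [set c' | forall g x,
      cmap_app (phi c' g) x = psi c' x (cmap_app g x)], G) => //=; split.
    exact: filterI.
  apply: nbhs_cmap.
  - apply: compact_closedI => //.
    apply: (@closed_comp _ _ (cmap_app f)); last exact: closed_closure.
    by move=> y _; exact: cmap_app_continuous.
  - exact: open_interior.
  - by move=> y [_]; exact: VY.
move=> [y [c' g]] /= [[X1y Vy] [[C1c' ->] Gg]] Ky.
apply: (sub (c', y, cmap_app g y)); split => /=; first exact: sub1.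
apply: interior_subset; apply: Gg; split => //.
exact: subset_closure.
Qed.

(** * Moving a map along a cofibration *)

(** Finite sequences of indices, ordered by inclusion, form a filter, for which the
    near-covering form of compactness is the existence of a finite
    subcover. *)
Lemma compact_seq_cover (A : topologicalType) (f : A -> set A) :
  compact [set: A] -> (forall a, nbhs a (f a)) ->
  exists s : seq A, forall a, exists2 a', a' \in s & f a' a.
Proof.
move=> cA nf.
pose F : set_system (seq A) :=
  filter_from setT (fun s : seq A => [set r : seq A | {subset s <= r}]).
have FF : Filter F.
  apply: filter_from_filter; first by exists [::].
  move=> s r _ _; exists (s ++ r) => // t st /=.
  by split=> x xs; apply: st; rewrite mem_cat xs ?orbT.
have [s _ sP] : \forall s \near F, [set: A] `<=`
    (fun a => exists2 a', a' \in s & f a' a).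
  apply: (iffLR (compact_near_coveringP _) cA _ F (fun s a =>
    exists2 a', a' \in s & f a' a)) => a _.
  exists (f a, [set r : seq A | {subset [:: a] <= r}]) => /=.
    by split; [exact: nf|exists [:: a]].
  by move=> [a' r] /= [faa' ar]; exists a => //; apply: ar; rewrite inE.
by exists s => a; exact: (sP s _ a I).
Qed.

(** At the apex, continuity has to be uniform in [a]: the tube lemma provides a
    single neighbourhood of [(c, 0)] for all [a]. *)
Lemma continuous_cone_extension (R : realType) (C A Y : topologicalType)
    (h : C -> A -> R -> Y) (y0 : Y) (c : C) : compact [set: A] ->
  (forall a t, {for (c, a, t),
    continuous (fun z : C * A * R => h z.1.1 z.1.2 z.2)}) ->
  (forall a, h c a 0 = y0) ->
  forall w : open_cone A R, {for (c, w),
    continuous (fun z : C * open_cone A R =>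
      if z.2 is Some p then h z.1 p.1 p.2 else y0)}.
Proof.
move=> cA ch h0 [[a t]|] O /= nO.
  have [[CA T] /= [[[C1 A1] /= [nC nA] sub1] nT] sub] := ch a t _ nO.
  exists (C1, Some @` [set p | A1 p.1 /\ T p.2]).
    by split => //=; apply: nbhs_cone_Some; exists (A1, T).
  move=> [c' _] /= [C1c' [[a' t'] [A1a' Tt'] <-]].
  by apply: (sub (c', a', t')); split => //=; exact: sub1.
have : \forall z \near (c, 0 : R), [set: A] `<=` (fun a => O (h z.1 a z.2)).
  apply: (iffLR (compact_near_coveringP _) cA _ (nbhs (c, 0 : R))
    (fun z a => O (h z.1 a z.2))) => a _.
  have nO' : nbhs (h c a 0) O by rewrite h0.
  have [[CA T] /= [[[C1 A1] /= [nC nA] sub1] nT] sub] := ch a 0 _ nO'.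
  exists (A1, C1 `*` T) => /=; first by split => //; exists (C1, T).
  move=> [a' [c' t']] /= [A1a' [C1c' Tt']].
  by apply: (sub (c', a', t')); split => //=; exact: sub1.
move=> [[C1 T] /= [nC /nbhs_ballP[e /= e0 eT]] sub].
exists (C1, [set y | forall p, y = Some p -> `|p.2| < e]).
  by split => //=; exact: nbhs_cone_None.
move=> [c' [[a' t']|]] /= [C1c' te]; last exact: nbhs_singleton nO.
apply: (sub (c', t')) => //; split => //=; apply: eT.
by rewrite -ball_normE /ball_ /= sub0r normrN; exact: (te (a', t')).
Qed.

Section Motions.
Context (R : realType) (E : normedModType R) (A X M : topologicalType).
Context (i : continuousType A X) (k : X -> open_cone A R) (b : cmap A M).
Hypothesis cA : compact [set: A].
Hypothesis regM : regular_space M.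
Hypothesis ck : continuous k.
Hypothesis ki : forall a, k (i a) = Some (a, 1).

(** A family of homeomorphisms of [M] parametrized by [cmap A M] and [X].  The
    functions are total, but nothing is asked of them outside [U]. *)
Definition motion (U : set (cmap A M)) (psi psi' : cmap A M -> X -> M -> M)
    : Prop :=
  forall c x y, U c ->
    [/\ {for (c, x, y), continuous
          (fun z : cmap A M * X * M => psi z.1.1 z.1.2 z.2)},
        {for (c, x, y), continuous
          (fun z : cmap A M * X * M => psi' z.1.1 z.1.2 z.2)},
        psi' c x (psi c x y) = y & psi c x (psi' c x y) = y].

(** Germ at [b] of a motion that brings [b a] to [c a] for all [a] in [D].  It
    does nothing to [b a] when [c] is [b] itself, which guarantees that for [c]
    close to [b] the points already moved are still in the charts where the
    next steps take place. *)
Definition motion_to (D : set A) : Prop :=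
  exists U psi psi',
    [/\ open_nbhs b U, motion U psi psi',
        forall a, psi b (i a) (cmap_app b a) = cmap_app b a &
        forall c a, U c -> D a -> psi c (i a) (cmap_app b a) = cmap_app c a].

Lemma motion_to0 : motion_to set0.
Proof.
exists setT, (fun _ _ y => y), (fun _ _ y => y); split => //.
  by split => //; exact: openT.
by move=> c x y _; split => //; exact: cvg_snd.
Qed.

Lemma motion_toS (D D' : set A) : D `<=` D' -> motion_to D' -> motion_to D.
Proof.
move=> DD' [U [psi [psi' [nU mot pb pD]]]]; exists U, psi, psi'; split => //.
by move=> c a Uc /DD' Da; exact: pD.
Qed.

(** [u c a] is the current position of [b a], [zeta c a] the displacement that
    has to be performed, cut off by the bump function, and [xi] its extension
    to [X].  Where [u c a] is already [c a] the displacement is zero; where the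
    bump function is 1 it leads exactly to [c a].  The new motion is defined for
    the maps [c] in [W], for which both [u c a] and [c a] lie in the patch
    whenever [b a] is in the core. *)
Lemma motion_to_push (D : set A) (P : pushing E M) : motion_to D ->
  motion_to (D `|` [set a | push_bump P (cmap_app b a) = 1]).
Proof.
move=> [U [psi [psi' [[oU Ub] mot pb pD]]]].
pose u c a := psi c (i a) (cmap_app b a).
pose zeta c a := push_bump P (cmap_app b a) *:
  (push_coord P (cmap_app c a) - push_coord P (u c a)).
pose xi c x : E := if k x is Some p then p.2 *: zeta c p.1 else 0.
(* the collar has height 1 on A, so xi extends zeta *)
have xii c a : xi c (i a) = zeta c a by rewrite /xi ki /= scale1r.
have ci : continuous i by exact: cts_fun.
have cu c a : U c -> {for (c, a), continuous (fun z : _ * A => u z.1 z.2)}.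
  move=> Uc; apply: (@continuous_comp _ _ _
    (fun z : cmap A M * A => (z.1, i z.2, cmap_app b z.2))
    (fun z : cmap A M * X * M => psi z.1.1 z.1.2 z.2)).
    apply: continuous_at_pair; first apply: continuous_at_pair.
    - exact: cvg_fst.
    - by apply: (@continuous_comp _ _ _ snd i); [exact: cvg_snd|exact: ci].
    - apply: (@continuous_comp _ _ _ snd (cmap_app b)); first exact: cvg_snd.
      exact: cmap_app_continuous.
  by have [] := mot c (i a) (cmap_app b a) Uc.
have core_near a : ~ push_core P (cmap_app b a) ->
    \forall a' \near a, ~ push_core P (cmap_app b a').
  move=> na; apply: (@cmap_app_continuous _ _ b a (~` push_core P)).
  apply: open_nbhs_nbhs; split => //.
  exact/closed_openC/push_core_closed.
pose W := U `&` [set c | forall a, push_core P (cmap_app b a) ->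
  push_dom P (cmap_app c a) /\ push_dom P (u c a)].
have nW : nbhs b W.
  apply: filterI; first exact: open_nbhs_nbhs.
  have : \forall c \near b, [set: A] `<=` (fun a =>
      push_core P (cmap_app b a) ->
      push_dom P (cmap_app c a) /\ push_dom P (u c a)).
    apply: (iffLR (compact_near_coveringP _) cA _ (nbhs b) (fun c a =>
      push_core P (cmap_app b a) ->
      push_dom P (cmap_app c a) /\ push_dom P (u c a))) => a _.
    have [Ca|nCa] := pselect (push_core P (cmap_app b a)); last first.
      exists ([set a' | ~ push_core P (cmap_app b a')], setT) => /=.
        by split; [exact: core_near|exact: filterT].
      by move=> [a' c] /= [].
    have dom_nbhs : nbhs (cmap_app b a) (push_dom P).
      apply: open_nbhs_nbhs; split; first exact: push_dom_open.
      exact: push_core_dom.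
    have dom_nbhs' : nbhs (u b a) (push_dom P) by rewrite /u pb.
    have [[C1 A1] /= [nC1 nA1] s1] :=
      @cmap_eval_continuous _ _ cA regM (b, a) _ dom_nbhs.
    have [[C2 A2] /= [nC2 nA2] s2] := cu b a Ub _ dom_nbhs'.
    exists (A1 `&` A2, C1 `&` C2) => /=; first by split; exact: filterI.
    move=> [a' c] /= [[A1a A2a] [C1c C2c]] _.
    by split; [exact: (s1 (c, a'))|exact: (s2 (c, a'))].
  by apply: filterS => c Hc a; exact: Hc.
have czeta c a : W c ->
    {for (c, a), continuous (fun z : _ * A => zeta z.1 z.2)}.
  move=> [Uc Wc]; have [Ca|nCa] := pselect (push_core P (cmap_app b a)).
    have [dc du] := Wc a Ca.
    apply: cvgZ.
      apply: (@continuous_comp _ _ _ (fun z : cmap A M * A => cmap_app b z.2)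
        (push_bump P)).
        apply: (@continuous_comp _ _ _ snd (cmap_app b)); first exact: cvg_snd.
        exact: cmap_app_continuous.
      exact/push_bump_continuous/push_core_dom.
    apply: cvgB.
      apply: (@continuous_comp _ _ _ (fun z : cmap A M * A => cmap_app z.1 z.2)
        (push_coord P)); first exact: cmap_eval_continuous.
      exact: push_coord_continuous.
    apply: (@continuous_comp _ _ _ (fun z : cmap A M * A => u z.1 z.2)
        (push_coord P)); first exact: cu.
    exact: push_coord_continuous.
  apply: (@continuous_at_near _ _ _ (fun=> 0)); first exact: cvg_cst.
  apply: (filterS (P := snd @^-1` [set a' | ~ push_core P (cmap_app b a')])).
    by move=> [c' a'] /= na; rewrite /zeta push_bump0// scale0r.
  by apply: (@cvg_snd _ _ (nbhs c) (nbhs a)); exact: core_near.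
have cxi c x : W c -> {for (c, x), continuous (fun z : _ * X => xi z.1 z.2)}.
  move=> Wc; apply: (@continuous_comp _ _ _ (fun z : _ * X => (z.1, k z.2))
    (fun z : _ * open_cone A R =>
      if z.2 is Some p then p.2 *: zeta z.1 p.1 else 0)).
    apply: continuous_at_pair; first exact: cvg_fst.
    by apply: (@continuous_comp _ _ _ snd k); [exact: cvg_snd|exact: ck].
  apply: (@continuous_cone_extension _ _ _ _
    (fun c a (t : R) => t *: zeta c a)) => //= [a t|a].
    apply: cvgZ; first exact: cvg_snd.
    apply: (@continuous_comp _ _ _ fst (fun z : _ * A => zeta z.1 z.2)).
      exact: cvg_fst.
    exact: czeta.
  by rewrite scale0r.
exists (interior W), (fun c x y => push P (xi c x) (psi c x y)),
  (fun c x y => psi' c x (push P (- xi c x) y)); split.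
- by split; [exact: open_interior|exact: nW].
- move=> c x y /interior_subset Wc.
  have cxi1 z : {for (c, x, z),
      continuous (fun z : cmap A M * X * M => xi z.1.1 z.1.2)}.
    apply: (@continuous_comp _ _ _ fst (fun z : _ * X => xi z.1 z.2)).
      exact: cvg_fst.
    exact: cxi.
  split.
  + apply: (@continuous_at_comp2 _ _ _ _ _ (push P)
      (fun z : cmap A M * X * M => xi z.1.1 z.1.2)
      (fun z : cmap A M * X * M => psi z.1.1 z.1.2 z.2)) => //.
      by have [] := mot c x y Wc.1.
    exact: push_continuous.
  + apply: (@continuous_comp _ _ _
      (fun z : cmap A M * X * M => (z.1, push P (- xi z.1.1 z.1.2) z.2))
      (fun z : cmap A M * X * M => psi' z.1.1 z.1.2 z.2)).
      apply: continuous_at_pair; first exact: cvg_fst.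
      apply: (@continuous_at_comp2 _ _ _ _ _ (push P)
        (fun z : cmap A M * X * M => - xi z.1.1 z.1.2) snd) => //.
      * by apply: cvgN; exact: cxi1.
      * exact: cvg_snd.
      * exact: push_continuous.
    by have [] := mot c x (push P (- xi c x) y) Wc.1.
  + by rewrite pushN; have [] := mot c x y Wc.1.
  + have [_ _ _ ->] := mot c x (push P (- xi c x) y) Wc.1.
    by rewrite -{1}(opprK (xi c x)) pushN.
- move=> a; rewrite pb xii /zeta /u pb subrr scaler0; exact: push0.
- move=> c a /interior_subset[Uc Wc] [Da|/= b1]; rewrite xii /zeta -/(u c a).
    by rewrite {1 2}/u pD// subrr scaler0 push0.
  rewrite b1 scale1r; have Ca : push_core P (cmap_app b a).
    apply: contrapT => nCa; have /eqP := push_bump0 nCa.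
    by rewrite b1 oner_eq0.
  by have [dc du] := Wc a Ca; exact: pushE.
Qed.

Lemma motion_to_all :
  (forall p : M, exists P : pushing E M, nbhs p [set q | push_bump P q = 1]) ->
  motion_to setT.
Proof.
move=> cover_push.
have [P nP] := choice (fun a => cover_push (cmap_app b a)).
pose f a := [set a' | push_bump (P a) (cmap_app b a') = 1].
have [|s sf] := compact_seq_cover cA (f := f).
  move=> a.
  exact: (@cmap_app_continuous _ _ b a [set q | push_bump (P a) q = 1] (nP a)).
suff mD (r : seq A) : motion_to [set a | exists2 a', a' \in r & f a' a].
  by apply: motion_toS (mD s) => a _; exact: sf.
elim: r {s sf} => [|a s IH]; first by apply: motion_toS motion_to0 => a [].
apply: motion_toS (motion_to_push (P a) IH) => a' [a''].
rewrite inE => /predU1P[->|sa''] fa; last by left; exists a''.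
by right.
Qed.

End Motions.

(** The default [d] makes the construction total, as the motions are continuous
    only over an open set of maps. *)
Definition cmap_of (X Y : topologicalType) (h : X -> Y) (d : cmap X Y) :
    cmap X Y :=
  if pselect (continuous h) is left ch then (mkcts ch : continuousType X Y)
  else d.

Lemma cmap_ofE (X Y : topologicalType) (h : X -> Y) (d : cmap X Y) :
  continuous h -> cmap_app (cmap_of h d) = h.
Proof. by move=> ch; rewrite /cmap_of; case: pselect. Qed.

Lemma precomp_app (A X Y : topologicalType) (i : continuousType A X)
    (f : cmap X Y) a : cmap_app (precomp i f) a = cmap_app f (i a).
Proof. by []. Qed.

Lemma precomp_continuous (A X Y : topologicalType) (i : continuousType A X) :
  continuous (@precomp A X Y i).
Proof.
move=> f.
apply: (@cvg_cmap _ (nbhs f) _ _ _ _ (nbhs_filter f)) => K O cK oO fKO.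
have cK' : compact (i @` K).
  apply: continuous_compact => //; apply: continuous_subspaceT.
  exact: cts_fun.
have fK' x : (i @` K) x -> O (cmap_app f x) by move=> [a Ka <-]; exact: fKO.
apply: filterS (nbhs_cmap cK' oO fK') => g gK a Ka.
by rewrite precomp_app; apply: gK; exists a.
Qed.

(** A motion acts on the maps from [X] to [M] pointwise, above the graph of the
    map. *)
Lemma precomp_transportable (R : realType) (E : normedModType R)
    (A X M : topologicalType) (i : continuousType A X) :
  compact [set: A] -> cofibration R i -> regular_space M ->
  (forall p : M, exists P : pushing E M, nbhs p [set q | push_bump P q = 1]) ->
  transportable (@precomp A X M i).
Proof.
move=> cA cof regM cover_push b.
have [k ck ki] := cofibration_collar cof.
have [U [psi [psi' [nU mot _ pD]]]] := motion_to_all b cA regM ck ki cover_push.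
have mot_at (g : cmap A M -> X -> M -> M) c (f : cmap X M) :
    (forall x y, {for (c, x, y), continuous
      (fun z : cmap A M * X * M => g z.1.1 z.1.2 z.2)}) ->
    continuous (fun x => g c x (cmap_app f x)).
  move=> cg x; apply: (@continuous_comp _ _ _ (fun x => (c, x, cmap_app f x))
    (fun z : cmap A M * X * M => g z.1.1 z.1.2 z.2)); last exact: cg.
  apply: continuous_at_pair; last exact: cmap_app_continuous.
  by apply: continuous_at_pair; [exact: cvg_cst|exact: cvg_id].
pose F c f := cmap_of (fun x => psi c x (cmap_app f x)) f.
pose G c f := cmap_of (fun x => psi' c x (cmap_app f x)) f.
have FE c f x : U c -> cmap_app (F c f) x = psi c x (cmap_app f x).
  move=> Uc; rewrite /F cmap_ofE//; apply: mot_at => x' y.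
  by have [] := mot c x' y Uc.
have GE c f x : U c -> cmap_app (G c f) x = psi' c x (cmap_app f x).
  move=> Uc; rewrite /G cmap_ofE//; apply: mot_at => x' y.
  by have [] := mot c x' y Uc.
exists U => //; exists F, G => c f Uc.
have nUc : \forall c' \near c, U c'.
  by apply: open_nbhs_nbhs; split => //; exact: nU.1.
split.
- apply: (@cmap_fibrewise_continuous _ _ _ psi) => // [x|].
    by have [] := mot c x (cmap_app f x) Uc.
  by apply: filterS nUc => c' Uc' g x; exact: FE.
- apply: (@cmap_fibrewise_continuous _ _ _ psi') => // [x|].
    by have [] := mot c x (cmap_app f x) Uc.
  by apply: filterS nUc => c' Uc' g x; exact: GE.
- apply: cmap_eqP => x; rewrite GE// FE//.
  by have [] := mot c x (cmap_app f x) Uc.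
- apply: cmap_eqP => x; rewrite FE// GE//.
  by have [] := mot c x (cmap_app f x) Uc.
- split=> pf; apply: cmap_eqP => a; rewrite precomp_app.
    by rewrite FE// -precomp_app pf pD.
  rewrite GE// -precomp_app pf -(pD c a)//.
  by have [] := mot c (i a) (cmap_app b a) Uc.
Qed.

Theorem theorem4p1 (R : realType) (n : nat) (A X : topologicalType)
    (M : smoothManifold R n) (i : continuousType A X)
    (compactA : compact [set: A]) (cofib_i : cofibration R i)
    (g : cmap A M) :
  let Z := connected_component [set: cmap A M] g in
  locally_trivial_bundle (restrict_over (@precomp A X M i) Z).
Proof.
move=> Z; apply: transportable_locally_trivial.
- exact: precomp_continuous.
- apply: (@precomp_transportable R 'rV[R]_n) => //.
    exact: manifold_regular.
  exact: manifold_pushing.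
- exact: component_connected.
Qed.
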